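(* For every positive integer $n$, the matrix $A_n + g_J(n) I_n$ has an integer completely positive factorization, where $A_n$ is the $n\times n$ matrix with entries $(A_n)_{ij}=(j-i)^2$ and $g_J(n) := \sum_{k=1}^{n-1} J_2(k)$, with $J_2$ the Jordan totient function.
   Context: A real symmetric $n\times n$ matrix $A$ has an integer completely positive factorization if $A=BB^T$ for some $n\times k$ matrix $B$ (for some $k$) all of whose entries are non-negative integers. The Jordan totient function is $J_2(k) := k^2\prod_{p\mid k,\ p\text{ prime}}\left(1-\frac{1}{p^2}\right)$ for positive integers $k$. $I_n$ is the $n\times n$ identity matrix. *)

(* Defs.v *)
From mathcomp Require Import all_boot all_order all_algebra.
From mathcomp Require Import reals.
Set Implicit Arguments.
Unset Strict Implicit.
Unset Printing Implicit Defensive.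
Import Order.TTheory GRing.Theory Num.Theory.
Local Open Scope ring_scope.

(* Symmetry of A is not required separately: it follows from A = B *m B^T. *)
Definition int_cp_factorizable (R : realType) (n : nat) (A : 'M[R]_n) : Prop :=
  exists (k : nat) (B : 'M[R]_(n, k)),
    (forall i j, B i j \is a Num.nat) /\ A = B *m B^T.

(* [primes k] lists each prime divisor of k > 0 exactly once. *)
Definition jordan2 (R : realType) (k : nat) : R :=
  k%:R ^+ 2 * \prod_(p <- primes k) (1 - 1 / p%:R ^+ 2).

Definition gJ (R : realType) (n : nat) : R := \sum_(1 <= k < n) jordan2 R k.

(* Indices run over 0, ..., n-1 rather than 1, ..., n; this does not affect
   the differences j - i, which are taken in R, not truncated in nat. *)
Definition sqdist_mx (R : realType) (n : nat) : 'M[R]_n :=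
  \matrix_(i < n, j < n) (j%:R - i%:R) ^+ 2.

(* Main.v *)
Require Import Defs.
From mathcomp Require Import all_boot all_order all_algebra.
From mathcomp Require Import reals.
Set Implicit Arguments.
Unset Strict Implicit.
Unset Printing Implicit Defensive.
Import Order.TTheory GRing.Theory Num.Theory.
Local Open Scope ring_scope.

(** The proof rests on Gauss's identity [m ^ 2 = \sum_(d | m) J_2(d)].  Off the
    diagonal it gives [(j - i)^2 = \sum_(1 <= d < n) J_2(d) [d | j - i]], since
    every divisor of the nonzero integer [j - i] is less than [n].  On the
    diagonal every [d] divides [j - i = 0], so the same sum equals [g_J(n)]:
    this is exactly what the multiple of the identity supplies.  Hence the
    matrix of the theorem is [\sum_(1 <= d < n) J_2(d) C_d], where [C_d] is the
    matrix of congruence modulo [d] ([sqdist_mx_gJ_decomposition]).  Each [C_d]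
    is the sum over the residue classes modulo [d] of [v *m v^T], with [v] the
    indicator vector of the class.  As [J_2(d)] is a natural number and the
    matrices with an integer completely positive factorization form an additive
    monoid, the theorem follows.

    Both facts about [J_2] come from one recursion ([jordan2_prime_mul]): for
    [p] prime, [J_2(p d)] is [p^2 J_2(d)] if [p] divides [d], and
    [(p^2 - 1) J_2(d)] otherwise. *)

(** * The monoid of integer completely positive matrices *)

Lemma int_cp0 (R : realType) n : int_cp_factorizable (0 : 'M[R]_n).
Proof.
by exists 0%N, 0; split=> [i []|] //; rewrite mul0mx.
Qed.

(** Concatenating the two factors adds the Gram matrices. *)
Lemma int_cpD (R : realType) n (A B : 'M[R]_n) :
  int_cp_factorizable A -> int_cp_factorizable B ->
  int_cp_factorizable (A + B).
Proof.
move=> [k [C [C_nat ->]]] [l [D [D_nat ->]]].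
exists (k + l)%N, (row_mx C D); split; last by rewrite tr_row_mx mul_row_col.
by move=> i j; rewrite mxE; case: split.
Qed.

Lemma int_cp_sum (R : realType) n (I : Type) (r : seq I) (P : pred I)
    (F : I -> 'M[R]_n) :
  (forall i, P i -> int_cp_factorizable (F i)) ->
  int_cp_factorizable (\sum_(i <- r | P i) F i).
Proof.
by move=> cpF; apply: big_ind => //; [exact: int_cp0 | exact: int_cpD].
Qed.

Lemma int_cp_scale_nat (R : realType) n (a : R) (A : 'M[R]_n) :
  a \is a Num.nat -> int_cp_factorizable A -> int_cp_factorizable (a *: A).
Proof.
case/natrP=> m -> cpA; rewrite scaler_nat -[m]card_ord -sumr_const.
exact: int_cp_sum.
Qed.

Definition congruence_mx (R : realType) (n d : nat) : 'M[R]_n :=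
  \matrix_(i < n, j < n) (i == j %[mod d])%:R.

(** The columns of the factor are the indicators of the residue classes. *)
Lemma int_cp_congruence_mx (R : realType) n d :
  (0 < d)%N -> int_cp_factorizable (congruence_mx R n d).
Proof.
move=> d_gt0.
exists d, (\matrix_(i, r) (i %% d == r)%:R)%N; split=> [i r|].
  by rewrite mxE natr_nat.
apply/matrixP=> i j; rewrite !mxE.
rewrite (bigD1 (Ordinal (ltn_pmod i d_gt0))) //= !mxE /= eqxx mul1r.
rewrite big1 => [|r ne_r]; first by rewrite addr0 eq_sym.
by rewrite !mxE eq_sym (negPf (ne_r : _ != _ :> nat)) mul0r.
Qed.

(** * Arithmetic of the Jordan totient *)

Lemma perm_primes_prime_mul p d : prime p -> (0 < d)%N ->
  perm_eq (primes (p * d)) (if p %| d then primes d else p :: primes d)%N.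
Proof.
move=> p_pr d_gt0; have p_gt0 := prime_gt0 p_pr.
apply: uniq_perm; first exact: primes_uniq.
  case: ifPn => [_|pNd]; first exact: primes_uniq.
  by rewrite /= primes_uniq mem_primes (negPf pNd) !andbF.
move=> q; rewrite primesM // primes_prime // inE.
case: ifP => p_d; last by rewrite inE.
by case: eqP => // ->; rewrite mem_primes p_pr d_gt0 p_d.
Qed.

(** A prime already dividing [d] adds no factor to the product, while a new one
    adds [1 - 1 / p^2].  Writing the resulting ratio as the image of a natural
    number is what makes integrality of [J_2] an immediate induction. *)
Lemma jordan2_prime_mul (R : realType) p d : prime p -> (0 < d)%N ->
  jordan2 R (p * d) =
    (if p %| d then p ^ 2 else (p ^ 2).-1)%N%:R * jordan2 R d.
Proof.
move=> p_pr d_gt0; have p_gt0 := prime_gt0 p_pr.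
rewrite /jordan2 (perm_big _ (perm_primes_prime_mul p_pr d_gt0)) /=.
case: ifP => _; first by rewrite natrM exprMn natrX -mulrA.
have p2_neq0 : p%:R ^+ 2 != 0 :> R.
  by rewrite -natrX pnatr_eq0 -lt0n expn_gt0 p_gt0.
rewrite big_cons natrM exprMn -subn1 natrB ?expn_gt0 ?p_gt0 // natrX.
rewrite mulrACA; congr (_ * _).
by rewrite mulrBr mulr1 mulrCA mulfV ?mulr1.
Qed.

Lemma jordan2_1 (R : realType) : jordan2 R 1 = 1.
Proof. by rewrite /jordan2 big_nil mulr1 expr1n. Qed.

Lemma prime_mul_ind (P : nat -> Prop) :
  P 1%N -> (forall p m, prime p -> (0 < m)%N -> P m -> P (p * m)%N) ->
  forall m, (0 < m)%N -> P m.
Proof.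
move=> P1 PM; elim/ltn_ind=> m IHm m_gt0.
have [m_le1 | m_gt1] := leqP m 1.
  by have /eqP -> : m == 1%N by rewrite eqn_leq m_le1.
have p_pr := pdiv_prime m_gt1; have p_m := pdiv_dvd m.
have q_gt0 : (0 < m %/ pdiv m)%N by rewrite divn_gt0 ?pdiv_gt0 // pdiv_leq.
rewrite -(divnK p_m) mulnC; apply: PM => //; apply: IHm => //.
by rewrite ltn_Pdiv // prime_gt1.
Qed.

Lemma jordan2_nat (R : realType) d : (0 < d)%N -> jordan2 R d \is a Num.nat.
Proof.
move=> d_gt0; elim/prime_mul_ind: d / d_gt0 => [|p d p_pr d_gt0 IHd].
  by rewrite jordan2_1.
by rewrite jordan2_prime_mul // rpredM ?natr_nat.
Qed.

(** A divisor of [p * m] is either a multiple [p * e], and then [e] divides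
    [m], or coprime to [p], and then it divides [m] already. *)
Lemma perm_divisors_prime_mul p m : prime p -> (0 < m)%N ->
  perm_eq (divisors (p * m))
    ([seq p * e | e <- divisors m] ++ [seq d <- divisors m | ~~ (p %| d)])%N.
Proof.
move=> p_pr m_gt0; have p_gt0 := prime_gt0 p_pr.
apply: uniq_perm; first exact: divisors_uniq.
  rewrite cat_uniq filter_uniq ?divisors_uniq // andbT.
  rewrite map_inj_uniq ?divisors_uniq /=; last first.
    by move=> x y /eqP; rewrite eqn_pmul2l // => /eqP.
  apply/hasPn=> d; rewrite mem_filter => /andP[pNd _].
  by apply/mapP=> -[e _ def_d]; rewrite def_d dvdn_mulr in pNd.
move=> d; rewrite mem_cat mem_filter -!dvdn_divisors ?muln_gt0 ?p_gt0 //.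
apply/idP/orP=> [d_pm | [/mapP[e] | /andP[_ d_m]]]; last first.
- exact: dvdn_mull.
- by rewrite -dvdn_divisors // => e_m ->; rewrite dvdn_pmul2l.
have [/dvdnP[e def_d] | pNd] := boolP (p %| d)%N.
  left; apply/mapP; exists e; last by rewrite mulnC.
  by rewrite -dvdn_divisors // -(dvdn_pmul2l p_gt0) mulnC -def_d.
by right; rewrite -(Gauss_dvdr m (_ : coprime d p)) // coprime_sym prime_coprime.
Qed.

(** Multiplying [m] by a prime [p] multiplies the divisor sum by [p^2].  The
    divisors [p * e] contribute [p^2 J_2(e)] or [(p^2 - 1) J_2(e)] according
    to whether [p] divides [e]; in the second case [e] itself is also a divisor
    prime to [p], and its [J_2(e)] makes up the difference. *)
Lemma sum_jordan2_divisors (R : realType) m : (0 < m)%N ->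
  \sum_(d <- divisors m) jordan2 R d = m%:R ^+ 2.
Proof.
move=> m_gt0; elim/prime_mul_ind: m / m_gt0 => [|p m p_pr m_gt0 IHm].
  by rewrite big_seq1 jordan2_1 expr1n.
rewrite (perm_big _ (perm_divisors_prime_mul p_pr m_gt0)) /=.
rewrite big_cat big_map big_filter /= natrM exprMn -IHm mulr_sumr.
rewrite [X in _ + X]big_mkcond -big_split /=.
apply: eq_big_seq => e; rewrite -dvdn_divisors // => e_m.
rewrite jordan2_prime_mul //; last exact: dvdn_gt0 e_m.
case: ifP => _ /=; first by rewrite addr0 natrX.
rewrite -[X in _ + X]mul1r -mulrDl -[1]/(1%:R) -natrD addn1 prednK ?natrX //.
by rewrite expn_gt0 prime_gt0.
Qed.

Lemma sum_jordan2_dvdn (R : realType) n m : (0 < m < n)%N ->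
  \sum_(1 <= d < n | (d %| m)%N) jordan2 R d = m%:R ^+ 2.
Proof.
case/andP=> m_gt0 m_lt_n; rewrite -sum_jordan2_divisors // -big_filter.
apply: perm_big; apply: uniq_perm; rewrite ?divisors_uniq ?filter_uniq ?iota_uniq //.
move=> d; rewrite mem_filter mem_index_iota -dvdn_divisors //.
apply: andb_idr => d_m; rewrite (dvdn_gt0 m_gt0 d_m).
exact: leq_ltn_trans (dvdn_leq m_gt0 d_m) m_lt_n.
Qed.

(** * Decomposition into congruence matrices *)

Lemma sum_jordan2_congruence (R : realType) n i j : (i < j < n)%N ->
  \sum_(1 <= d < n) jordan2 R d * (i == j %[mod d])%N%:R
    = (j%:R - i%:R) ^+ 2.
Proof.
case/andP=> lt_ij lt_jn; have le_ij := ltnW lt_ij.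
rewrite -natrB // -(@sum_jordan2_dvdn R n); last first.
  by rewrite subn_gt0 lt_ij (leq_ltn_trans (leq_subr _ _)).
rewrite [RHS]big_mkcond; apply: eq_bigr => d _.
by rewrite eq_sym eqn_mod_dvd //; case: ifP => _; rewrite ?mulr1 ?mulr0.
Qed.

Lemma sqdist_mx_gJ_decomposition (R : realType) n :
  sqdist_mx R n + gJ R n *: 1%:M
    = \sum_(1 <= d < n) jordan2 R d *: congruence_mx R n d.
Proof.
apply/matrixP=> i j; rewrite summxE !mxE.
under eq_bigr => d _ do rewrite !mxE.
have [lt_ij | lt_ji | /val_inj ->] := ltngtP i j.
- rewrite sum_jordan2_congruence ?lt_ij ?ltn_ord //.
  by rewrite -val_eqE /= ltn_eqF // mulr0 addr0.
- under eq_bigr => d _ do rewrite eq_sym.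
  rewrite sum_jordan2_congruence ?lt_ji ?ltn_ord //.
  by rewrite -val_eqE /= gtn_eqF // mulr0 addr0 -sqrrN opprB.
rewrite subrr expr0n eqxx mulr1 add0r.
by apply: eq_bigr => d _; rewrite eqxx mulr1.
Qed.

Theorem theorem13 (R : realType) (n : nat) (hn : (0 < n)%N) :
  int_cp_factorizable (sqdist_mx R n + gJ R n *: 1%:M).
Proof.
rewrite sqdist_mx_gJ_decomposition big_nat.
apply: int_cp_sum => d /andP[d_gt0 _].
apply: int_cp_scale_nat; first exact: jordan2_nat.
exact: int_cp_congruence_mx.
Qed.
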